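(* Let $\mathbf{W}_{up},\mathbf{W}_{gate}\in\mathbb{R}^{D\times d}$, $\mathbf{W}_{down}\in\mathbb{R}^{d\times D}$, and let $\mathsf{FG}(\mathbf{x})=\mathbf{W}_{down}\big(\sigma^*(\mathbf{W}_{gate}\mathbf{x})\odot\mathbf{W}_{up}\mathbf{x}\big)$, where $\sigma^*$ is the entrywise application of the SiLU function $\sigma(x)=x/(1+\exp(-x))$. For every $\mathbf{x}\in\mathbb{R}^d$, the value of $\mathsf{FG}(\mathbf{x})$ computed in floating-point arithmetic satisfies (entrywise) $$|\mathsf{fl}(\mathsf{FG}(\mathbf{x}))-\mathsf{FG}(\mathbf{x})|\le\Big(4\mathsf{u}_w+\tfrac{13}{2}\mathsf{u}_q+\tfrac94\gamma_{MM}(d)+\gamma_{MM}(D)+\mathcal{O}(\mathsf{u}_q^2)\Big)|\mathbf{W}_{down}|\Big(|\mathbf{W}_{gate}||\mathbf{x}|\odot|\mathbf{W}_{up}||\mathbf{x}|\Big).$$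
   Context: $\odot$ is the entrywise product; absolute values and inequalities of vectors/matrices are entrywise; $\mathsf{fl}(\cdot)$ denotes the computed value. Floating-point model. There are unit round-offs $\mathsf{u}_w\le\mathsf{u}_a\ll\mathsf{u}_q$ (working, accumulation, quantisation precision). In working precision every arithmetic operation and every elementary function (such as $\exp$) returns the exact result for its actual operands multiplied by $1+\delta$, $|\delta|\le\mathsf{u}_w$. A matrix product with operands $\mathbf{W}\in\mathbb{R}^{m\times k}$, $\mathbf{X}\in\mathbb{R}^{k\times n}$ is computed with error $$|\mathsf{fl}(\mathbf{W}\mathbf{X})-\mathbf{W}\mathbf{X}|\le\big(\gamma_{MM}(k)+\gamma(2,\mathsf{u}_q)+\gamma_{MM}(k)\gamma(2,\mathsf{u}_q)\big)|\mathbf{W}||\mathbf{X}|,$$ where $\gamma(n,\mathsf{u})=n\mathsf{u}/(1-n\mathsf{u})$ and $\gamma_{MM}(k)=\gamma_{MM}(k,\mathsf{u}_a)\ge0$ is a constant depending on the summation algorithm, of first order in $\mathsf{u}_a$ (e.g. $\gamma(k,\mathsf{u}_a)$ for recursive summation). Algorithm: $\mathbf{W}_{up}\mathbf{x}$ and $\mathbf{W}_{gate}\mathbf{x}$ are computed as matrix products; $\sigma$ is evaluated entrywise in working precision by its formula (exponential, addition, division); the entrywise product is computed in working precision; finally the matrix product with $\mathbf{W}_{down}$ is computed. Each step acts on the computed results of the previous ones. $\mathcal{O}(\mathsf{u}_q^2)$ is as $\mathsf{u}_q\to0$ with $\mathbf{x}$ and the weights fixed. *)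

(* Defs.v *)
From HB Require Import structures.
From mathcomp Require Import all_boot all_order all_algebra.
From mathcomp Require Import all_classical all_reals all_analysis.
Set Implicit Arguments.
Unset Strict Implicit.
Unset Printing Implicit Defensive.
Import Order.TTheory GRing.Theory Num.Theory.
Import numFieldNormedType.Exports.
Local Open Scope classical_set_scope.
Local Open Scope ring_scope.

Definition abs_mx (R : realType) (m n : nat) (A : 'M[R]_(m, n)) : 'M[R]_(m, n) :=
  map_mx (fun a : R => `|a|) A.

Definition hadamard (R : realType) (m n : nat) (A B : 'M[R]_(m, n)) :
    'M[R]_(m, n) :=
  map2_mx (fun a b : R => a * b) A B.

Definition le_mx (R : realType) (m n : nat) (A B : 'M[R]_(m, n)) : Prop :=
  forall i j, A i j <= B i j.

Definition silu (R : realType) (z : R) : R := z / (1 + expR (- z)).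

Definition FG (R : realType) (d D : nat) (Wup Wgate : 'M[R]_(D, d))
    (Wdown : 'M[R]_(d, D)) (x : 'cV[R]_d) : 'cV[R]_d :=
  Wdown *m hadamard (map_mx (@silu R) (Wgate *m x)) (Wup *m x).

(* Only meaningful when n * u < 1. *)
Definition gam (R : realType) (n : nat) (u : R) : R := n%:R * u / (1 - n%:R * u).

(* [gMM k u] is the constant of the summation algorithm for inner products of
   length k accumulated with unit round-off u. Both conditions are asymptotic
   because typical instances, such as [gam], are nonnegative only for small
   u. *)
Definition summation_constant (R : realType) (gMM : nat -> R -> R) : Prop :=
  forall k : nat,
    (\forall u \near 0^'+, 0 <= gMM k u) /\ gMM k =O_ (0^'+) (fun u : R => u).

(* The floating-point model does not determine the computed values: the
   predicates [fl_*] below say that the last argument is a value which the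
   model allows for the operation. *)

Definition fl_op (R : realType) (uw exact computed : R) : Prop :=
  exists2 delta : R, `|delta| <= uw & computed = exact * (1 + delta).

(* [g] is the constant [gMM k ua] for the inner dimension k. *)
Definition fl_mulmx (R : realType) (g uq : R) (m k n : nat) (W : 'M[R]_(m, k))
    (X : 'M[R]_(k, n)) (Y : 'M[R]_(m, n)) : Prop :=
  le_mx (abs_mx (Y - W *m X))
    ((g + gam 2 uq + g * gam 2 uq) *: (abs_mx W *m abs_mx X)).

(* The negation of z is exact: it is not one of the rounded operations. *)
Definition fl_silu (R : realType) (uw z y : R) : Prop :=
  exists e s : R,
    [/\ fl_op uw (expR (- z)) e, fl_op uw (1 + e) s & fl_op uw (z / s) y].

Definition fl_FG (R : realType) (gMM : nat -> R -> R) (uw ua uq : R)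
    (d D : nat) (Wup Wgate : 'M[R]_(D, d)) (Wdown : 'M[R]_(d, D))
    (x y : 'cV[R]_d) : Prop :=
  exists up gate act prod : 'cV[R]_D,
    [/\ fl_mulmx (gMM d ua) uq Wup x up,
        fl_mulmx (gMM d ua) uq Wgate x gate,
        forall i j, fl_silu uw (gate i j) (act i j),
        forall i j, fl_op uw (act i j * up i j) (prod i j)
      & fl_mulmx (gMM D ua) uq Wdown prod y].

(* Main.v *)
(* The derivative of SiLU is bounded by 5/4 and |silu z| <= |z|, so the relative
   error eps ~ gMM d + 2 uq of the two first products contributes
   (5/4 + 1) eps = 9/4 gMM d + 9/2 uq to the gated product, and the four
   working-precision roundings contribute 4 uw; the last product adds
   gMM D + 2 uq. All cross terms are O(uq^2) because uw, gMM d ua and gMM D ua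
   are O(uq) when uw <= ua <= uq. *)

Require Import Defs.
From HB Require Import structures.
From mathcomp Require Import all_boot all_order all_algebra.
From mathcomp Require Import all_classical all_reals all_analysis.
From mathcomp Require Import ring lra.
Set Implicit Arguments.
Unset Strict Implicit.
Unset Printing Implicit Defensive.
Import Order.TTheory GRing.Theory Num.Theory.
Import numFieldNormedType.Exports.
Local Open Scope classical_set_scope.
Local Open Scope ring_scope.

(** * Growth and Lipschitz bounds for SiLU *)

Lemma normr_silu_le (R : realType) (z : R) : `|silu z| <= `|z|.
Proof.
have E0 := expR_gt0 (- z).
rewrite /silu normrM normfV (gtr0_norm (addr_gt0 ltr01 E0)).
by rewrite ler_pdivrMr ?addr_gt0// ler_peMr//; lra.
Qed.

Definition dsilu (R : realType) (z : R) : R :=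
  (1 + expR (- z) + z * expR (- z)) / (1 + expR (- z)) ^+ 2.

Lemma is_derive_silu (R : realType) (z : R) :
  is_derive z 1 (@silu R) (dsilu z).
Proof.
have E0 := expR_gt0 (- z).
have D0 : 1 + expR (- z) != 0 by rewrite gt_eqF// addr_gt0.
have dE : is_derive z 1 (fun y : R => 1 + expR (- y)) (- expR (- z)).
  have dN : is_derive z 1 (expR \o -%R) (expR (- z) * -1).
    exact: is_derive1_comp.
  have := is_deriveD (is_derive_cst (1 : R) z 1) dN.
  by rewrite add0r mulrN1.
have := is_deriveM (is_derive_id z 1) (@is_deriveV _ (fun y => 1 + expR (- y)) _ _ _ D0 dE).
move=> dzE; apply: (is_derive_eq dzE).
by rewrite /dsilu /GRing.scale /=; field.
Qed.

(** Clearing the denominator leaves two polynomial bounds in [E] and [z * E]: the upper one follows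
    from z E <= E + 1/4, the lower one from E (E - (1 - z)) >= 0. *)
Lemma normr_dsilu_le (R : realType) (z : R) : `|dsilu z| <= 5 / 4.
Proof.
have E0 := expR_gt0 (- z).
set E := expR (- z) in E0 *.
rewrite /dsilu -/E ler_norml -[- (5 / 4)]mulNr.
rewrite ler_pdivlMr ?ler_pdivrMr ?exprn_gt0 ?addr_gt0//.
have E1 : 1 - z <= E by apply: expR_ge1Dx.
(* [exp z = exp 1 ^ 2 * exp (z - 2) >= 4 (z - 1)] *)
have zE : (4 * z - 4) * E <= 1.
  have e1 : 2 <= expR 1 :> R by apply: le_trans (expR_ge1Dx 1); lra.
  have e2 : z - 1 <= expR (z - 2) by apply: le_trans (expR_ge1Dx _); lra.
  have e3 : 4 * z - 4 <= expR z.
    have -> : expR z = expR 1 * expR 1 * expR (z - 2).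
      by rewrite -!expRD; congr expR; ring.
    have e4 : 4 <= expR 1 * expR 1 :> R.
      by have := ler_pM (ler0n R 2) (ler0n R 2) e1 e1; lra.
    have e5 := expR_gt0 (z - 2).
    apply: (@le_trans _ _ (4 * expR (z - 2))); first by lra.
    by rewrite ler_pM2r.
  apply: (@le_trans _ _ (expR z * E)); first by rewrite ler_pM2r.
  by rewrite /E -expRD subrr expR0.
have : 0 <= (E - (1 - z)) * E by rewrite mulr_ge0// ?subr_ge0// ltW.
have E2 : 0 <= E ^+ 2 by rewrite sqr_ge0.
by move=> ?; apply/andP; split; nra.
Qed.

Lemma silu_lipschitz (R : realType) (z t : R) :
  `|silu z - silu t| <= 5 / 4 * `|z - t|.
Proof.
wlog ztle : z t / t <= z.
  move=> H; have [/H//|/ltW/H] := leP t z.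
  by rewrite distrC (distrC t).
have [||c _ ->] := @MVT_segment _ (@silu R) (@dsilu R) _ _ ztle.
- by move=> y _; exact: is_derive_silu.
- apply: derivable_within_continuous => y _.
  exact: (@ex_derive _ _ _ _ _ _ _ (is_derive_silu y)).
- by rewrite normrM ler_wpM2r// normr_dsilu_le.
Qed.

(** * Working-precision roundings *)

(** The numerator holds the roundings of the division and the entrywise product, the denominator
    those of the exponential and the addition. They differ by at most 4 v + 2 v^2, the denominator
    is at least 1 - 2 v, and K = 20 is the least constant with 4 v + 2 v^2 <= (4 v + K v^2) (1 - 2
    v) for all v up to 1/4. *)
Lemma rounding_quotient (R : realType) (v a b c e : R) :
  v <= 1 / 4 -> `|a| <= v -> `|b| <= v -> `|c| <= v -> `|e| <= v ->
  `|(1 + a) * (1 + b) / ((1 + c) * (1 + e)) - 1| <= 4 * v + 20 * v ^+ 2.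
Proof.
move=> v4 av bv cv ev.
have v0 : 0 <= v by apply: le_trans av.
have [abv cev] : `|a * b| <= v ^+ 2 /\ `|c * e| <= v ^+ 2.
  by rewrite !normrM expr2; split; rewrite ler_pM.
move: av bv cv ev abv cev; rewrite !ler_norml.
move=> /andP[a1 a2] /andP[b1 b2] /andP[c1 c2] /andP[e1 e2].
move=> /andP[ab1 ab2] /andP[ce1 ce2].
have v2 : v ^+ 2 <= v / 4 by rewrite expr2 ler_wpM2l//; lra.
have c0 : 0 < 1 + c by lra.
have e0 : 0 < 1 + e by lra.
have q0 : 0 < (1 + c) * (1 + e) by rewrite mulr_gt0.
(* The factors are lowered to 1 - v one after the other, and (1 - v)^2 >= 1 - 2 v. *)
have qge : 1 - 2 * v <= (1 + c) * (1 + e).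
  have : 0 <= (c + v) * (1 + e) by rewrite mulr_ge0//; lra.
  have : 0 <= (1 - v) * (e + v) by rewrite mulr_ge0//; lra.
  have := sqr_ge0 v; lra.
have -> : (1 + a) * (1 + b) / ((1 + c) * (1 + e)) - 1
    = (a + b + a * b - c - e - c * e) / ((1 + c) * (1 + e)).
  by field; rewrite !gt_eqF.
rewrite -mulNr ler_pdivlMr// ler_pdivrMr//.
have : (4 * v + 20 * v ^+ 2) * (1 - 2 * v)
    <= (4 * v + 20 * v ^+ 2) * ((1 + c) * (1 + e)).
  by rewrite ler_wpM2l// addr_ge0// mulr_ge0// sqr_ge0.
have : 0 <= v ^+ 2 * (1 / 4 - v) by rewrite mulr_ge0 ?sqr_ge0//; lra.
have := sqr_ge0 v.
by move=> ? ? ?; apply/andP; split; nra.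
Qed.

(* A relative error [delta] in [exp (- z)] is a relative error [t * delta] in
   [1 + exp (- z)], with [t = exp (- z) / (1 + exp (- z))] in [0, 1]. *)
Lemma fl_silu_mul_error (R : realType) (v z w act p : R) :
  v <= 1 / 4 -> fl_silu v z act -> fl_op v (act * w) p ->
  `|p - silu z * w| <= (4 * v + 20 * v ^+ 2) * `|silu z * w|.
Proof.
move=> v4 [e [s [[d1 d1v ->] [d2 d2v ->] [d3 d3v ->]]]] [d4 d4v ->].
have E0 := expR_gt0 (- z); set E := expR (- z) in E0 *.
have E1 : 0 < 1 + E by rewrite addr_gt0.
set c := E / (1 + E) * d1.
have cv : `|c| <= v.
  have t0 : 0 <= E / (1 + E) by rewrite divr_ge0// ltW.
  apply: le_trans d1v; rewrite normrM (ger0_norm t0) ler_piMl//.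
  by rewrite ler_pdivrMr//; lra.
have := rounding_quotient v4 d3v d4v cv d2v.
have c0 : 1 + c != 0.
  by move: cv; rewrite ler_norml => /andP[? ?]; rewrite gt_eqF//; lra.
have d0 : 1 + d2 != 0.
  by move: d2v; rewrite ler_norml => /andP[? ?]; rewrite gt_eqF//; lra.
have -> : 1 + E * (1 + d1) = (1 + E) * (1 + c).
  by rewrite /c; field; rewrite gt_eqF.
set q := (X in `|X - 1|).
have -> : z / ((1 + E) * (1 + c) * (1 + d2)) * (1 + d3) * w * (1 + d4)
    = q * (silu z * w).
  by rewrite /q /silu -/E; field; rewrite c0 d0 gt_eqF.
move=> qle; rewrite -[X in _ - X]mul1r -mulrBl normrM.
by rewrite ler_wpM2r.
Qed.

(** * Error of the gated product *)

(** Equal to (1 + g) (1 + gam 2 u) - 1, two relative errors compounded. *)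
Definition mm_err (R : realType) (g u : R) : R := g + gam 2 u + g * gam 2 u.

(* Relative error of the gated product when its two factors come from matrix
   products of relative error [eps] and the roundings amount to [rho]. *)
Definition prod_err (R : realType) (eps rho : R) : R :=
  9 / 4 * eps + 5 / 4 * eps ^+ 2 + (1 + eps) ^+ 2 * rho.

(** Here [a] and [b] stand for entries of |Wgate| |x| and |Wup| |x|: the errors of the matrix
    products are relative to these, not to [z] and [w]. *)
Lemma gated_product_error (R : realType) (eps rho a b z w zh wh p : R) :
  0 <= eps -> 0 <= rho -> `|z| <= a -> `|w| <= b ->
  `|zh - z| <= eps * a -> `|wh - w| <= eps * b ->
  `|p - silu zh * wh| <= rho * `|silu zh * wh| ->
  `|p - silu z * w| <= prod_err eps rho * (a * b).
Proof.
move=> eps0 rho0 za wb zhz whw pe.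
have a0 : 0 <= a by apply: le_trans za.
have b0 : 0 <= b by apply: le_trans wb.
have zha : `|zh| <= (1 + eps) * a.
  by rewrite -[zh](subrK z) mulrDl mul1r addrC (le_trans (ler_normD _ _))// lerD.
have whb : `|wh| <= (1 + eps) * b.
  by rewrite -[wh](subrK w) mulrDl mul1r addrC (le_trans (ler_normD _ _))// lerD.
have t1 : `|p - silu zh * wh| <= rho * (((1 + eps) * a) * ((1 + eps) * b)).
  apply: le_trans pe _; rewrite ler_wpM2l// normrM ler_pM//.
  exact: le_trans (normr_silu_le zh) _.
have t2 : `|(silu zh - silu z) * wh| <= 5 / 4 * (eps * a) * ((1 + eps) * b).
  rewrite normrM ler_pM// (le_trans (silu_lipschitz _ _))//.
  by rewrite ler_wpM2l//; lra.
have t3 : `|silu z * (wh - w)| <= a * (eps * b).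
  by rewrite normrM ler_pM// (le_trans (normr_silu_le z)).
(* The three telescoping terms contribute rho (1 + eps)^2, 5/4 eps (1 + eps) and eps, which add up
   to [prod_err]. *)
have -> : p - silu z * w = p - silu zh * wh + (silu zh - silu z) * wh
    + silu z * (wh - w) by ring.
apply: le_trans (ler_normD _ _) _.
apply: le_trans (lerD (ler_normD _ _) (lexx _)) _.
apply: le_trans (lerD (lerD t1 t2) t3) _.
by rewrite le_eqVlt; apply/orP; left; apply/eqP; rewrite /prod_err; field.
Qed.

(** * First-order expansion of the error factors *)

Lemma gam2_ge0 (R : realType) (u : R) : 0 <= u <= 1 / 4 -> 0 <= gam 2 u.
Proof. by move=> /andP[? ?]; rewrite /gam divr_ge0//; lra. Qed.

Lemma gam2_le (R : realType) (u : R) :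
  0 <= u <= 1 / 4 -> gam 2 u <= 2 * u + 8 * u ^+ 2.
Proof.
move=> /andP[u0 u4]; rewrite /gam ler_pdivrMr; last by lra.
(* The difference (2 u + 8 u^2) (1 - 2 u) - 2 u is 16 times this product. *)
have : 0 <= u ^+ 2 * (1 / 4 - u) by rewrite mulr_ge0 ?sqr_ge0//; lra.
by rewrite -subr_ge0 => ?; nra.
Qed.

Lemma mm_err_ge0 (R : realType) (g u : R) :
  0 <= g -> 0 <= u <= 1 / 4 -> 0 <= mm_err g u.
Proof. by move=> g0 /gam2_ge0 ?; rewrite /mm_err !addr_ge0// mulr_ge0. Qed.

(** The cross term is at most (C u) (4 u), and [gam2_le] supplies the 8 u^2. *)
Lemma mm_err_le (R : realType) (C g u : R) :
  0 <= g <= C * u -> 0 <= u <= 1 / 4 ->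
  mm_err g u <= g + 2 * u + (8 + 4 * C) * u ^+ 2.
Proof.
move=> /andP[g0 gC] u04; have ga := gam2_le u04; have ga0 := gam2_ge0 u04.
case/andP: u04 => u0 u4.
have u2 : u ^+ 2 <= u / 4 by rewrite expr2 ler_wpM2l//; lra.
have ga4 : gam 2 u <= 4 * u by lra.
have := ler_pM g0 ga0 gC ga4.
by rewrite /mm_err; lra.
Qed.

(* [A u^2] bounds the second-order part of [mm_err g u], [B u] bounds all of it,
   and [K u^2] bounds the second-order part of [prod_err]. *)
Definition quad_const (R : realType) (C : R) : R :=
  let A := 8 + 4 * C in let B := 2 * C + 4 in
  let K := 9 / 4 * A + 5 / 4 * B ^+ 2 + 20 + 27 * B in
  A + K + B * (9 / 4 * B + 5 / 4 * B + 36).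

(** The left side is the factor of [fl_FG_error], with [v], [g], [G], [u] for [uw], [gMM d ua],
    [gMM D ua], [uq]. First-order terms stay separate; every product of two small quantities is
    absorbed into u^2. *)
Lemma total_err_le (R : realType) (C v g G u : R) :
  0 <= C -> 0 <= v <= u -> 0 <= g <= C * u -> 0 <= G <= C * u ->
  0 <= u <= 1 / 4 -> (2 * C + 4) * u <= 1 ->
  let kappa := prod_err (mm_err g u) (4 * v + 20 * v ^+ 2) in
  kappa + mm_err G u * (1 + kappa)
    <= 4 * v + 13 / 2 * u + 9 / 4 * g + G + quad_const C * u ^+ 2.
Proof.
move=> C0 vu gC GC u04.
have e1 := mm_err_le gC u04; have f1 := mm_err_le GC u04.
have e0 := mm_err_ge0 (proj1 (andP gC)) u04.
have f0 := mm_err_ge0 (proj1 (andP GC)) u04.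
rewrite /quad_const; set A := 8 + 4 * C; set B := 2 * C + 4 => Bu1.
have B0 : 0 <= B by rewrite /B; lra.
case/andP: vu => v0 vu; case/andP: gC => g0 gC; case/andP: GC => G0 GC.
case/andP: u04 => u0 u4.
have u2 : u ^+ 2 <= u / 4 by rewrite expr2 ler_wpM2l//; lra.
have Au : A * u ^+ 2 <= A * (u / 4) by rewrite ler_wpM2l// /A; lra.
(* As u^2 <= u / 4, the total is at most (C + 2) u + A u / 4 = B u. *)
have eB : mm_err g u <= B * u by apply: le_trans e1 _; rewrite /A /B in Au *; lra.
have fB : mm_err G u <= B * u by apply: le_trans f1 _; rewrite /A /B in Au *; lra.
move: (mm_err g u) (mm_err G u) e0 f0 e1 f1 eB fB => e f e0 f0 e1 f1 eB fB.
set rho := 4 * v + 20 * v ^+ 2.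
have v2 : v ^+ 2 <= v / 4 by rewrite expr2 ler_wpM2l//; lra.
have v2u : v ^+ 2 <= u ^+ 2 by rewrite lerXn2r.
have rho0 : 0 <= rho by rewrite /rho addr_ge0// mulr_ge0// sqr_ge0.
have rho9 : rho <= 9 * u by rewrite /rho; lra.
(* The smallness of [B * u] enters here; it lets powers of [e] be lowered below. *)
have e11 : e <= 1 by lra.
have e2 : e ^+ 2 <= B ^+ 2 * u ^+ 2 by rewrite -exprMn lerXn2r// nnegrE; lra.
have e2e : e ^+ 2 <= e by rewrite expr2 ler_piMr.
have er : e * rho <= B * u * (9 * u) by rewrite ler_pM.
have e2r : e ^+ 2 * rho <= e * rho by rewrite ler_wpM2r.
have err : e * rho <= rho by rewrite ler_piMl.
have kE : prod_err e rho
    = 9 / 4 * e + 5 / 4 * e ^+ 2 + rho + 2 * (e * rho) + e ^+ 2 * rho.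
  by rewrite /prod_err; ring.
have k0 : 0 <= prod_err e rho.
  by rewrite /prod_err !addr_ge0// mulr_ge0// sqr_ge0.
(* Crude linear bound: e^2 <= e, and the terms with [rho] total at most 4 rho <= 36 u. *)
have kB : prod_err e rho <= (9 / 4 * B + 5 / 4 * B + 36) * u by rewrite kE; lra.
have fk : f * prod_err e rho <= B * u * ((9 / 4 * B + 5 / 4 * B + 36) * u).
  by rewrite ler_pM.
rewrite /= mulrDr mulr1 [in X in X + _]kE.
have rhoE : rho = 4 * v + 20 * v ^+ 2 by [].
have {}e1 : e <= g + 2 * u + A * u ^+ 2 by [].
have {}f1 : f <= G + 2 * u + A * u ^+ 2 by [].
move: (prod_err e rho) fk => k fk.
move: fk e1 f1 e2 er e2r rhoE v2u; clear => fk e1 f1 e2 er e2r rhoE v2u.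
clearbody A B rho; lra.
Qed.

(** * Entrywise bounds through the whole computation *)

Lemma normr_mulmx_le (R : realType) (m k n : nat) (W : 'M[R]_(m, k))
    (X : 'M[R]_(k, n)) i j : `|(W *m X) i j| <= (abs_mx W *m abs_mx X) i j.
Proof.
rewrite !mxE (le_trans (ler_norm_sum _ _ _))//.
by apply: ler_sum => l _; rewrite !mxE normrM.
Qed.

Lemma le_mx_abs_mulmx (R : realType) (m k n : nat) (W : 'M[R]_(m, k))
    (A B : 'M[R]_(k, n)) : le_mx A B -> le_mx (abs_mx W *m A) (abs_mx W *m B).
Proof.
move=> AB i j; rewrite !mxE; apply: ler_sum => l _.
by rewrite ler_wpM2l// !mxE.
Qed.

(** Let P be the exact gated product and H its majorant. The error splits as (y - Wdown prd) + Wdown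
    (prd - P). The second term costs kappa; the first is relative to the computed [prd], whose size
    is at most (1 + kappa) H, hence the factor 1 + kappa. *)
Lemma fl_FG_error (R : realType) (gMM : nat -> R -> R) (uw ua uq : R)
    (d D : nat) (Wup Wgate : 'M[R]_(D, d)) (Wdown : 'M[R]_(d, D))
    (x y : 'cV[R]_d) :
  0 <= uw <= 1 / 4 -> 0 <= uq <= 1 / 4 -> 0 <= gMM d ua -> 0 <= gMM D ua ->
  fl_FG gMM uw ua uq Wup Wgate Wdown x y ->
  let kappa := prod_err (mm_err (gMM d ua) uq) (4 * uw + 20 * uw ^+ 2) in
  le_mx (abs_mx (y - FG Wup Wgate Wdown x))
    ((kappa + mm_err (gMM D ua) uq * (1 + kappa)) *:
      (abs_mx Wdown *m
        hadamard (abs_mx Wgate *m abs_mx x) (abs_mx Wup *m abs_mx x))).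
Proof.
move=> /andP[w0 w4] q04 g0 G0 [up [gate [act [prd [hup hgate hact hprd hy]]]]].
have := mm_err_ge0 g0 q04; have := mm_err_ge0 G0 q04.
move: hup hgate hy; rewrite /fl_mulmx -/(mm_err _ _) -/(mm_err _ _).
set e := mm_err (gMM d ua) uq; set f := mm_err (gMM D ua) uq.
move=> hup hgate hy f0 e0; set kappa := prod_err _ _.
set H := hadamard _ (abs_mx Wup *m abs_mx x).
set P := hadamard (map_mx (@silu R) (Wgate *m x)) (Wup *m x).
have rho0 : 0 <= 4 * uw + 20 * uw ^+ 2 by rewrite addr_ge0// mulr_ge0// sqr_ge0.
have prdP : le_mx (abs_mx (prd - P)) (kappa *: H).
  move=> i j.
  have -> : abs_mx (prd - P) i j
      = `|prd i j - silu ((Wgate *m x) i j) * (Wup *m x) i j|.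
    by rewrite !mxE.
  have -> : (kappa *: H) i j = kappa
      * ((abs_mx Wgate *m abs_mx x) i j * (abs_mx Wup *m abs_mx x) i j).
    by rewrite !mxE.
  apply: (@gated_product_error _ _ _ _ _ _ _ (gate i j) (up i j)) => //.
  - exact: normr_mulmx_le.
  - exact: normr_mulmx_le.
  - apply: le_trans (le_trans (hgate i j) _); first by rewrite !mxE.
    by rewrite !mxE.
  - apply: le_trans (le_trans (hup i j) _); first by rewrite !mxE.
    by rewrite !mxE.
  - exact: fl_silu_mul_error (hact i j) (hprd i j).
have PH : le_mx (abs_mx P) H.
  move=> i j.
  have -> : abs_mx P i j = `|silu ((Wgate *m x) i j)| * `|(Wup *m x) i j|.
    by rewrite !mxE normrM.
  rewrite [H i j]mxE ler_pM ?normr_mulmx_le//.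
  by rewrite (le_trans (normr_silu_le _))// normr_mulmx_le.
have prdH : le_mx (abs_mx prd) ((1 + kappa) *: H).
  move=> i j; rewrite scalerDl scale1r [leRHS]mxE.
  apply: le_trans (lerD (PH i j) (prdP i j)).
  rewrite !mxE; set p := (X in `|X| + _).
  by rewrite -{1}[prd i j](subrKC p) ler_normD.
move=> i j; rewrite /FG -/P scalerDl [leRHS]mxE.
have -> : y - Wdown *m P = (y - Wdown *m prd) + Wdown *m (prd - P).
  by rewrite mulmxBr addrA subrK.
have -> : abs_mx (y - Wdown *m prd + Wdown *m (prd - P)) i j
    = `|(y - Wdown *m prd) i j + (Wdown *m (prd - P)) i j|.
  by rewrite mxE [in LHS]mxE.
rewrite addrC; apply: le_trans (ler_normD _ _) (lerD _ _).
  apply: le_trans (normr_mulmx_le _ _ _ _) _.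
  by rewrite scalemxAr; exact: le_mx_abs_mulmx.
have : `|(y - Wdown *m prd) i j| <= f * (abs_mx Wdown *m abs_mx prd) i j.
  by have := hy i j; rewrite mxE [leRHS]mxE.
move=> /le_trans; apply; rewrite -scalerA [leRHS]mxE ler_wpM2l//.
by rewrite scalemxAr; exact: le_mx_abs_mulmx.
Qed.

(** * Passage to the limit of small round-offs *)

Lemma bigO_at_right0 (R : realType) (f : R -> R) :
  f =O_ (0^'+) (fun u : R => u) ->
  exists2 C, 0 < C & \forall u \near 0^'+, `|f u| <= C * u.
Proof.
move=> /eqO_exP[C C0 fC]; exists C => //.
near=> u; have u0 : 0 < u by near: u; exact: nbhs_right_gt.
by rewrite -[X in C * X](gtr0_norm u0); near: u.
Unshelve. all: by end_near. Qed.

(** An explicit radius is needed because the bound is applied at [ua], which is chosen after [uq]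
    and ranges over values below it. *)
Lemma summation_constant_bound (R : realType) (gMM : nat -> R -> R) (k : nat) :
  summation_constant gMM ->
  exists C r : R, [/\ 0 < C, 0 < r &
    forall u, 0 < u -> u < r -> 0 <= gMM k u <= C * u].
Proof.
move=> /(_ k)[g0 /bigO_at_right0[C C0 gC]].
have : \forall u \near 0^'+, 0 <= gMM k u <= C * u.
  near=> u; have gu0 : 0 <= gMM k u by near: u.
  by rewrite gu0 -(ger0_norm gu0); near: u.
move=> [r /= r0 rP]; exists C, r; split=> // u u0 ur.
by apply: rP => //; rewrite /ball /= sub0r normrN gtr0_norm.
Unshelve. all: by end_near. Qed.

Theorem theorem4p4 (R : realType) (gMM : nat -> R -> R)
    (hgMM : summation_constant gMM) (d D : nat)
    (Wup Wgate : 'M[R]_(D, d)) (Wdown : 'M[R]_(d, D)) (x : 'cV[R]_d) :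
  exists2 E : R -> R, E =O_ (0^'+) (fun u : R => u ^+ 2) &
    \forall uq \near 0^'+, forall uw ua : R,
      0 < uw -> uw <= ua -> ua <= uq ->
      forall y : 'cV[R]_d, fl_FG gMM uw ua uq Wup Wgate Wdown x y ->
      le_mx (abs_mx (y - FG Wup Wgate Wdown x))
        ((4 * uw + 13 / 2 * uq + 9 / 4 * gMM d ua + gMM D ua + E uq) *:
          (abs_mx Wdown *m
            hadamard (abs_mx Wgate *m abs_mx x) (abs_mx Wup *m abs_mx x))).
Proof.
have [C1 [r1 [C10 r10 g1]]] := summation_constant_bound d hgMM.
have [C2 [r2 [C20 r20 g2]]] := summation_constant_bound D hgMM.
set C := C1 + C2.
have C0 : 0 < C by rewrite addr_gt0.
(* The remainder depends on [gMM], [d] and [D] only, not on the weights or [x]. *)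
exists (fun u => quad_const C * u ^+ 2).
  apply/eqO_exP; exists (1 + `|quad_const C|); first by rewrite ltr_pwDl.
  by apply: nearW => u; rewrite normrM ler_wpM2r// lerDr.
have B0 : 0 < 2 * C + 4 by lra.
near=> uq => uw ua uw0 uwa uaq y /fl_FG_error err.
have uq4 : uq <= 1 / 4 by near: uq; apply: nbhs_right_le; rewrite divr_gt0.
have Buq : (2 * C + 4) * uq <= 1.
  rewrite mulrC -ler_pdivlMr//.
  by near: uq; apply: nbhs_right_le; rewrite divr_gt0.
have uqr1 : uq < r1 by near: uq; exact: nbhs_right_lt.
have uqr2 : uq < r2 by near: uq; exact: nbhs_right_lt.
have ua0 : 0 < ua by exact: lt_le_trans uwa.
(* One constant [C] serves both inner dimensions and turns bounds in [ua] into bounds in [uq]. *)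
have CM : C1 * ua <= C * uq /\ C2 * ua <= C * uq.
  by split; apply: ler_pM; rewrite /C; lra.
have /andP[gd0 gd] := g1 _ ua0 (le_lt_trans uaq uqr1).
have /andP[gD0 gD] := g2 _ ua0 (le_lt_trans uaq uqr2).
move=> i j; apply: le_trans (err _ _ gd0 gD0 i j) _; [lra|lra|].
rewrite [leLHS]mxE [leRHS]mxE ler_wpM2r//.
  rewrite mxE; apply: sumr_ge0 => l _; rewrite !mxE !mulr_ge0 ?sumr_ge0//.
    by move=> k _; rewrite !mxE mulr_ge0.
  by move=> k _; rewrite !mxE mulr_ge0.
by apply: total_err_le; lra.
Unshelve. all: by end_near. Qed.
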